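(* For every $\varepsilon > 0$ there is a constant $c_\varepsilon > 0$ such that for all positive integers $n, k$ with $k \leq n^{1-\varepsilon}$, \[ \mathsf{CC}_k(\mathrm{Maj}_n) \geq c_\varepsilon \cdot \frac{n}{k} \log k. \]
   Context: $\mathrm{Maj}_n : \{0,1\}^n \to \{0,1\}$ outputs $1$ if $|x| = x_1 + \cdots + x_n \geq n/2$ and $0$ otherwise. A function $g : \{0,1\}^n \to \{0,1\}$ is $k$-local if there is a set $I \subseteq [n]$ with $|I| = k$ such that $g$ depends only on the variables in $I$ (i.e. $g(x) = g(x^{\oplus i})$ for every $x$ and every $i \notin I$, where $x^{\oplus i}$ is $x$ with its $i$-th coordinate flipped). The $k$-composition complexity $\mathsf{CC}_k(f)$ of a function $f : \{0,1\}^n \to D$ is the minimum integer $m$ such that there exist $k$-local functions $g_1, \ldots, g_m : \{0,1\}^n \to \{0,1\}$ and an arbitrary function $h : \{0,1\}^m \to D$ with $f(x) = h(g_1(x), \ldots, g_m(x))$ for all $x \in \{0,1\}^n$. Logarithms are base $2$. *)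

(* Defs.v *)
From mathcomp Require Import all_boot all_order all_algebra.
From mathcomp Require Import boolp reals exp.

Set Implicit Arguments.
Unset Strict Implicit.
Unset Printing Implicit Defensive.

Definition cube (n : nat) : Type := {ffun 'I_n -> bool}.

Definition flip (n : nat) (x : cube n) (i : 'I_n) : cube n :=
  [ffun j => if j == i then ~~ x j else x j].

Definition weight (n : nat) (x : cube n) : nat := \sum_(i < n) x i.

Definition Maj (n : nat) (x : cube n) : bool := n <= 2 * weight x.

Definition local (n k : nat) (g : cube n -> bool) : Prop :=
  exists I : {set 'I_n},
    #|I| = k /\ forall (x : cube n) (i : 'I_n), i \notin I -> g x = g (flip x i).

Definition composable (n : nat) (D : Type) (k : nat) (f : cube n -> D)
    (m : nat) : Prop :=
  exists (g : 'I_m -> cube n -> bool) (h : cube m -> D),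
    (forall j, local k (g j)) /\ forall x, f x = h [ffun j => g j x].

(* The default value 0 is returned only when no composition exists; by
   composable_ex this does not happen for 0 < k <= n. *)
Definition CC (n : nat) (D : Type) (k : nat) (f : cube n -> D) : nat :=
  if pselect (exists m, `[< composable k f m >]) is left e
  then ex_minn e else 0.

Definition log2 (R : realType) (x : R) : R := (ln x / ln 2%:R)%R.

Lemma composable_ex (n k : nat) (D : Type) (f : cube n -> D) :
  0 < k -> k <= n -> exists m, composable k f m.
Proof.
move=> k0 kn; exists n; exists (fun j x => x j), f; split; last first.
  by move=> x; congr f; apply/ffunP => j; rewrite ffunE.
move=> j.
have /card_geqP[s [us sk ss]] : k.-1 <= #|[set~ j]|.
  by rewrite cardsC1 card_ord -!subn1 leq_sub2r.
have js : j \notin s by apply/negP => /ss; rewrite !inE eqxx.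
exists [set i in j :: s]; split.
  have uj : uniq (j :: s) by rewrite /= js us.
  by rewrite cardsE (card_uniqP uj) /= sk prednK.
move=> x i; rewrite !inE negb_or => /andP[ij _].
by rewrite ffunE eq_sym (negbTE ij).
Qed.

Lemma CC_composable (n k : nat) (D : Type) (f : cube n -> D) :
  0 < k -> k <= n -> composable k f (CC k f).
Proof.
move=> k0 kn; rewrite /CC; case: pselect => [e|[]].
  by case: ex_minnP => m /asboolP.
by have [m fm] := composable_ex f k0 kn; exists m; apply/asboolP.
Qed.

Lemma CC_min (n k m : nat) (D : Type) (f : cube n -> D) :
  composable k f m -> CC k f <= m.
Proof.
move=> fm; rewrite /CC; case: pselect => [e|//].
by case: ex_minnP => m' _; apply; apply/asboolP.
Qed.

(* Main.v *)
Require Import Defs.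
From mathcomp Require Import all_boot all_order all_algebra all_field.
From mathcomp Require Import boolp reals exp.
From mathcomp Require Import ring lra zify.

(** Let [Maj_n = h(g_1, ..., g_m)] where [g_j] reads the set [S_j] of [k] variables,
    and let [r = mk/n] be the average number of functions reading a variable.
    At least half of the variables are read by at most [d = floor (2r)] functions.

    From majority to Hamming weight: for a random set [G] of functions, a variable of
    low degree is read only by functions in [G] (or only by functions outside [G])
    with probability at least [2^-d], so there are disjoint sets [A] and [B] of about
    [n / 4^d] variables such that [A] is read only inside [G] and [B] only outside.
    Setting the variables of [B] moves the threshold seen by [A] without affecting the
    functions in [G]; hence [g(x)] determines the weight [W(x)] of [x] on [A].

    Lower bound for Hamming weight: put [q = 2^(d+1)], let [w] be a primitive [q]-th
    root of unity, and consider the correlations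
    [psi_f(T) = \sum_x w^(f W(x)) \prod_(j in T) (-1)^(g_j(x))]. By Parseval,
    [\sum_T |psi_f(T)|^2 = Z] does not depend on [f], because [g] determines [W].
    Fix [i] in [A].  Only pairs [x, x'] with [W(x) = W(x')] modulo [q] survive the
    summation over [f], and they include all pairs with [g(x) = g(x')]; so, summed over
    all [f], the mass of the sets [T] avoiding the at most [d] functions that read [i]
    is at least [q 2^-d Z = 2Z], of which [f = 0] accounts for at most [Z].  Thus, over
    [f <> 0], the sets [T] have on average at least [|A|/q] variables of [A] read by no
    function in [T].  But every such variable contributes a factor [|1 + w^f|/2 <= 1 - Omega(1/q^2)] to [psi_f(T)],
    and there are only [2^m] sets [T].  Hence [|A| <= O(q^3 (m + d))], which gives
    [k <= 2^O(r)].  (If the variables read together with a given one exceed a constant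
    fraction of all variables, [A] and [B] need not exist, but then
    [m >= Omega((n/k)^2)], and [n/k >= k^eps].) *)

Set Implicit Arguments.
Unset Strict Implicit.
Unset Printing Implicit Defensive.

Import Order.TTheory GRing.Theory Num.Theory.

(** * From majority to Hamming weight *)

Definition weight_on (n : nat) (A : {set 'I_n}) (x : cube n) : nat :=
  \sum_(i in A) x i.

(** Induction on the Hamming distance: a coordinate where the points differ lies outside [I], so
    flipping it does not change [g]. *)
Lemma eq_of_agree (n : nat) (I : {set 'I_n}) (g : cube n -> bool) :
  (forall x i, i \notin I -> g x = g (flip x i)) ->
  forall x x' : cube n, (forall i, i \in I -> x i = x' i) -> g x = g x'.
Proof.
move=> gI x x'; move: {2}#|[set i | x i != x' i]| (leqnn #|[set i | x i != x' i]|) => s.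
elim: s x => [|s IHs] x.
  rewrite leqn0 cards_eq0 => /eqP E _; congr g; apply/ffunP => i.
  by apply/eqP/negPn/negP => xi; have := in_set0 i; rewrite -E inE xi.
move=> cs agr; have [E|[i]] := set_0Vmem [set i | x i != x' i].
  by apply: IHs => //; rewrite E cards0.
rewrite inE => xi; rewrite (gI x i); last first.
  by apply: contraNN xi => /agr ->.
apply: IHs => [|l lI].
  rewrite -ltnS; apply: leq_trans cs; apply: proper_card; apply/properP; split.
    apply/subsetP => l; rewrite !inE ffunE.
    by have [->|//] := eqVneq l i; rewrite xi.
  by exists i; rewrite !inE // ffunE eqxx; case: (x i) (x' i) xi => -[].
rewrite ffunE; case: eqP => [li|_]; last exact: agr.
by move: xi; rewrite -li agr // eqxx.
Qed.

Lemma exists_subset_card (T : finType) (A : {set T}) (s : nat) : s <= #|A| ->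
  exists2 B : {set T}, B \subset A & #|B| = s.
Proof.
case/card_geqP => l [ul sl lA]; exists [set x in l].
  by apply/subsetP => x; rewrite inE => /lA.
by rewrite cardsE (card_uniqP ul).
Qed.

Definition indicator (n : nat) (Q : {set 'I_n}) : cube n := [ffun i => i \in Q].

Definition patch (n : nat) (A : {set 'I_n}) (z x : cube n) : cube n :=
  [ffun i => if i \in A then x i else z i].

Lemma sum_mem_card (n : nat) (A Q : {set 'I_n}) :
  \sum_(i in A) (i \in Q : nat) = #|A :&: Q|.
Proof.
rewrite -sum1_card big_mkcond [RHS]big_mkcond /=; apply: eq_bigr => i _.
by rewrite inE; case: (i \in A); case: (i \in Q).
Qed.

Lemma weight_indicator (n : nat) (Q : {set 'I_n}) : weight (indicator Q) = #|Q|.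
Proof.
rewrite /weight (eq_bigr (fun i => (i \in Q : nat))); last by move=> i _; rewrite ffunE.
rewrite (eq_bigl (fun i => i \in [set: 'I_n])); last by move=> i; rewrite inE.
by rewrite sum_mem_card setTI.
Qed.

Lemma weight_patch (n : nat) (A Q : {set 'I_n}) (x : cube n) : [disjoint A & Q] ->
  weight (patch A (indicator Q) x) = weight_on A x + #|Q|.
Proof.
move=> dAQ; rewrite /weight (bigID (mem A)) /=; congr (_ + _).
  by apply: eq_bigr => i iA; rewrite ffunE iA.
rewrite (eq_bigr (fun i => (i \in Q : nat))); last first.
  by move=> i /negPf iA; rewrite !ffunE iA.
rewrite (eq_bigl (fun i => i \in ~: A)); last by move=> i; rewrite inE.
rewrite sum_mem_card; congr #|pred_of_set _|; apply/setIidPr.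
by rewrite -disjoints_subset disjoint_sym.
Qed.

Lemma weight_on_le (n : nat) (A : {set 'I_n}) (x : cube n) : weight_on A x <= #|A|.
Proof. by rewrite -sum1_card; apply: leq_sum => i _; case: (x i). Qed.

(** If two inputs with equal outputs had different weights on [A], turning on suitable variables of
    [B] would put the majority threshold between them. Functions in [G] do not see this change, and
    functions outside [G] do not read [A], so all outputs would still agree. *)
Lemma Maj_weight_determined (n m : nat) (g : 'I_m -> cube n -> bool) (h : cube m -> bool)
    (S : 'I_m -> {set 'I_n}) (G : {set 'I_m}) (A B : {set 'I_n}) :
  (forall j x i, i \notin S j -> g j x = g j (flip x i)) ->
  (forall x : cube n, Maj x = h [ffun j => g j x]) ->
  [disjoint A & B] -> #|A| = #|B| ->
  (forall i j, i \in A -> i \in S j -> j \in G) ->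
  (forall i j, i \in B -> i \in S j -> j \notin G) ->
  exists z : cube n, forall x x',
    (forall j, g j (patch A z x) = g j (patch A z x')) -> weight_on A x = weight_on A x'.
Proof.
move=> gS gh dAB cAB AG BG.
have cABn : #|A :|: B| = #|A| + #|B| by rewrite cardsU disjoint_setI0 // cards0 subn0.
have := cardsC (A :|: B); rewrite cABn card_ord -cAB => cC.
(* [uphalf n] is the least weight with majority 1. The subtraction does not truncate, since [A] and
   [B] are disjoint of equal size. *)
have [|R RC cR] := @exists_subset_card _ (~: (A :|: B)) (uphalf n - #|A|).
  by lia.
exists (indicator R).
suff lt_absurd x x' : (forall j, g j (patch A (indicator R) x) = g j (patch A (indicator R) x')) ->
    weight_on A x < weight_on A x' -> False.
  move=> x x' E; case: (ltngtP (weight_on A x) (weight_on A x')) => // lt.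
    by case: (lt_absurd _ _ E lt).
  by case: (lt_absurd x' x _ lt).
move=> E lt; have le' := weight_on_le A x'.
(* With [Q] switched on, [x'] reaches the threshold exactly and [x] stays below it. *)
have [|Q QB cQ] := @exists_subset_card _ B (#|A| - weight_on A x'); first by lia.
have dRQ : [disjoint R & Q].
  rewrite disjoints_subset; apply/subsetP => i /(subsetP RC); rewrite !inE negb_or.
  by case/andP => _; apply: contraNN => /(subsetP QB).
have cRQ : #|R :|: Q| = #|R| + #|Q| by rewrite cardsU disjoint_setI0 // cards0 subn0.
have dA : [disjoint A & R :|: Q].
  rewrite disjoints_subset; apply/subsetP => i iA; rewrite !inE negb_or.
  apply/andP; split.
    by apply/negP => /(subsetP RC); rewrite !inE iA.
  by apply/negP => /(subsetP QB) iB; have := disjointFr dAB iA; rewrite iB.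
have agr (y : cube n) j : j \in G ->
    g j (patch A (indicator (R :|: Q)) y) = g j (patch A (indicator R) y).
  move=> jG; apply: (eq_of_agree (gS j)) => i iS; rewrite !ffunE !inE.
  case: ifP => // _; case: (boolP (i \in Q)); rewrite ?orbF // => /(subsetP QB) iB.
  by move: (BG i j iB iS); rewrite jG.
have EM : Maj (patch A (indicator (R :|: Q)) x) = Maj (patch A (indicator (R :|: Q)) x').
  rewrite !gh; congr h; apply/ffunP => j; rewrite !ffunE.
  case: (boolP (j \in G)) => jG; first by rewrite !agr.
  apply: (eq_of_agree (gS j)) => i iS; rewrite !ffunE; case: ifP => // iA.
  by move: jG; rewrite (AG i j iA iS).
by move: EM; rewrite /Maj !weight_patch // cRQ cR cQ; lia.
Qed.

(** * Random splitting of the functions *)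

Lemma card_sets_between (m : nat) (a b : {set 'I_m}) : [disjoint a & b] ->
  2 ^ (m - #|a| - #|b|) <= #|[set G : {set 'I_m} | (a \subset G) && [disjoint b & G]]|.
Proof.
move=> dab; pose c := ~: (a :|: b).
have -> : m - #|a| - #|b| = #|c|.
  have := cardsC (a :|: b); rewrite cardsU disjoint_setI0 // cards0 subn0 card_ord /c.
  by lia.
rewrite -card_powerset -(card_in_imset (f := fun G => a :|: G)).
  apply: subset_leq_card; apply/subsetP => H /imsetP[G Gc ->].
  rewrite inE in Gc; rewrite inE.
  rewrite subsetUl /= disjoints_subset; apply/subsetP => j jb.
  rewrite !inE negb_or; apply/andP; split; first by rewrite (disjointFl dab jb).
  by apply/negP => /(subsetP Gc); rewrite !inE jb orbT.
move=> G G'; rewrite !inE => Gc G'c E.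
have aux (H : {set 'I_m}) : H \subset c -> (a :|: H) :\: a = H.
  move=> Hc; rewrite setDUl setDv set0U; apply/setDidPl.
  rewrite disjoints_subset; apply/subsetP => j /(subsetP Hc).
  by rewrite !inE negb_or => /andP[].
by rewrite -(aux G) // -(aux G') // E.
Qed.

(** First moment over uniform [G]: at least half of the pairs in [L] have disjoint neighbourhoods,
    and [G] contains the first and avoids the second with probability at least [4 ^ - d]. *)
Lemma exists_splitting (n m d e : nat) (L : {set 'I_n}) (Nb : 'I_n -> {set 'I_m}) :
  (forall i, i \in L -> #|Nb i| <= d) ->
  (forall i, i \in L -> #|[set i' in L | ~~ [disjoint Nb i & Nb i']]| <= e) ->
  2 * e <= #|L| ->
  exists G : {set 'I_m},
    #|L| ^ 2 <= 2 * 4 ^ d * (#|[set i in L | Nb i \subset G]| *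
                             #|[set i in L | [disjoint Nb i & G]]|).
Proof.
move=> degL eL e2; apply/existsP; apply: contraT; rewrite negb_exists => /forallP noG.
pose U (G : {set 'I_m}) := #|[set i in L | Nb i \subset G]|.
pose V (G : {set 'I_m}) := #|[set i in L | [disjoint Nb i & G]]|.
have cS : #|{set 'I_m}| = 2 ^ m.
  by rewrite -cardsT -powersetT card_powerset cardsT card_ord.
have up : 2 * 4 ^ d * \sum_G (U G * V G) < 2 ^ m * #|L| ^ 2.
  rewrite big_distrr /= -cS -sum_nat_const.
  have lt G : 2 * 4 ^ d * (U G * V G) + 1 <= #|L| ^ 2 by rewrite addn1 ltnNge noG.
  apply: leq_trans (leq_sum _ (fun G _ => lt G)).
  by rewrite big_split /= sum1_card cS -addn1 leq_add2l expn_gt0.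
have UV : \sum_G (U G * V G) = \sum_(i in L) \sum_(i' in L)
    #|[set G : {set 'I_m} | (Nb i \subset G) && [disjoint Nb i' & G]]|.
  transitivity (\sum_(G : {set 'I_m}) \sum_(i in L) \sum_(i' in L)
     ((Nb i \subset G) && [disjoint Nb i' & G] : nat)).
    apply: eq_bigr => G _.
    have sumE (p : pred 'I_n) : #|[set i in L | p i]| = \sum_(i in L) (p i : nat).
      rewrite -sum1_card big_mkcond [RHS]big_mkcond /=; apply: eq_bigr => i _.
      by rewrite inE; case: (i \in L); case: (p i).
    rewrite /U /V !sumE big_distrl /=; apply: eq_bigr => i _.
    by rewrite big_distrr /=; apply: eq_bigr => i' _; rewrite mulnb.
  rewrite exchange_big /=; apply: eq_bigr => i _.
  rewrite exchange_big /=; apply: eq_bigr => i' _.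
  by rewrite -sum1dep_card [RHS]big_mkcond; apply: eq_bigr => G _; case: ifP.
have low : 2 ^ m * (#|L| * (#|L| - e)) <= 4 ^ d * \sum_G (U G * V G).
  rewrite UV big_distrr /= mulnCA -sum_nat_const; apply: leq_sum => i iL.
  rewrite big_distrr /=.
  apply: (@leq_trans (\sum_(i' in L | [disjoint Nb i & Nb i']) 2 ^ m)).
    rewrite sum_nat_const mulnC leq_mul2r expn_eq0 /= leq_subLR.
    have -> : #|L| = #|[set i' in L | ~~ [disjoint Nb i & Nb i']]| +
        #|[pred i' | (i' \in L) && [disjoint Nb i & Nb i']]|.
      rewrite -[in RHS](cardsE [pred i' | _]) -(cardsID [set i' | ~~ [disjoint Nb i & Nb i']] L).
      congr (_ + _); apply: eq_card => l; rewrite !inE //.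
      by rewrite negbK andbC.
    by rewrite leq_add2r eL.
  rewrite big_mkcondr /=; apply: leq_sum => i' i'L; case: ifP => // dij.
  apply: leq_trans (leq_mul (leqnn _) (card_sets_between dij)).
  rewrite -[4]/(2 ^ 2) -expnM -expnD leq_exp2l //.
  by have := degL i iL; have := degL i' i'L; lia.
have : 2 ^ m * (#|L| ^ 2) <= 2 * (2 ^ m * (#|L| * (#|L| - e))).
  rewrite mulnCA leq_mul2l; apply/orP; right.
  by rewrite mulnCA -mulnn leq_mul2l; apply/orP; right; lia.
by move: low up; rewrite -!mulnA; lia.
Qed.

(** * How many functions read a variable *)

Lemma Maj_all_read (n m : nat) (g : 'I_m -> cube n -> bool) (h : cube m -> bool)
    (S : 'I_m -> {set 'I_n}) :
  (forall j x i, i \notin S j -> g j x = g j (flip x i)) ->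
  (forall x : cube n, Maj x = h [ffun j => g j x]) ->
  forall i, exists j, i \in S j.
Proof.
move=> gS gh i; apply/existsP; apply: contraT; rewrite negb_exists => /forallP noS.
have n0 : 0 < n by apply: leq_ltn_trans (ltn_ord i).
(* One below the threshold with variable [i] off, so that flipping [i] changes the majority. *)
have [|Q Qi cQ] := @exists_subset_card _ [set~ i] (uphalf n).-1.
  by rewrite cardsC1 card_ord; lia.
have iQ : i \notin Q by apply/negP => /(subsetP Qi); rewrite !inE eqxx.
have : Maj (indicator Q) = Maj (flip (indicator Q) i).
  by rewrite !gh; congr h; apply/ffunP => j; rewrite !ffunE; apply: gS.
have -> : flip (indicator Q) i = indicator (i |: Q).
  apply/ffunP => l; rewrite !ffunE !inE; case: eqP => [->|//].
  by rewrite (negPf iQ).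
by rewrite /Maj !weight_indicator cardsU1 iQ cQ; lia.
Qed.

(** Double counting. [Q = setT] gives the total degree; [Q = Nb i] bounds the number of variables
    sharing a function with [i]. *)
Lemma sum_degree (n m k : nat) (S : 'I_m -> {set 'I_n}) (Q : {set 'I_m}) :
  (forall j, #|S j| = k) -> \sum_(i < n) #|[set j in Q | i \in S j]| = #|Q| * k.
Proof.
move=> cS; transitivity (\sum_(i < n) \sum_(j in Q) (i \in S j : nat)).
  apply: eq_bigr => i _; rewrite -sum1dep_card big_mkcond [RHS]big_mkcond /=.
  by apply: eq_bigr => j _; case: (j \in Q); case: (i \in S j).
rewrite exchange_big /= -sum_nat_const; apply: eq_bigr => j _.
by rewrite -(cS j) -sum1_card [RHS]big_mkcond; apply: eq_bigr => i _; case: ifP.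
Qed.

(** Markov's inequality: the average degree is [m * k / n]. *)
Lemma card_low_degree (n m k : nat) (S : 'I_m -> {set 'I_n}) : 0 < n ->
  (forall j, #|S j| = k) ->
  n <= 2 * #|[set i | #|[set j in setT | i \in S j]| <= 2 * m * k %/ n]|.
Proof.
move=> n0 cS; set d := _ %/ n; set L := [set i | _ <= d].
have hi : #|~: L| * d.+1 <= m * k.
  have := sum_degree setT cS; rewrite cardsT card_ord => <-.
  rewrite -sum_nat_const big_mkcond; apply: leq_sum => i _; case: ifP => //.
  by rewrite !inE -ltnNge.
have := cardsC L; rewrite card_ord => cL.
have lt : 2 * m * k < d.+1 * n by rewrite -ltn_divLR.
rewrite leqNgt; apply/negP => hL.
have : n * d.+1 <= (2 * #|~: L|) * d.+1 by rewrite leq_mul2r; lia.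
by lia.
Qed.

(** * Hamming weight *)

Local Open Scope ring_scope.

(** * Roots of unity *)

Lemma sum_unity_root (q : nat) (z : algC) : z ^+ q = 1 -> z != 1 ->
  \sum_(f < q) z ^+ f = 0.
Proof.
move=> zq z1; apply/eqP.
have := subrX1 z q; rewrite zq subrr => /esym/eqP.
by rewrite mulf_eq0 subr_eq0 (negPf z1).
Qed.

Lemma norm_unity_root (q : nat) (z : algC) : (0 < q)%N -> z ^+ q = 1 -> `|z| = 1.
Proof.
move=> q0 zq; apply/eqP; rewrite -(@pexpr_eq1 _ _ q) //.
by rewrite -normrX zq normr1.
Qed.

(** The terms [1 - z ^+ f] for [f < q] sum to [q], and each has norm at most [q * |1 - z|]. *)
Lemma norm_sub_unity_root (q : nat) (z : algC) : (0 < q)%N -> z ^+ q = 1 -> z != 1 ->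
  1 <= q%:R * `|1 - z|.
Proof.
move=> q0 zq z1; have nz := norm_unity_root q0 zq.
have le1 (f : nat) : `|1 - z ^+ f| <= f%:R * `|1 - z|.
  elim: f => [|f IHf]; first by rewrite expr0 subrr normr0 mul0r.
  have -> : 1 - z ^+ f.+1 = (1 - z ^+ f) + z ^+ f * (1 - z).
    by rewrite mulrBr mulr1 -exprSr addrA subrK.
  apply: le_trans (ler_normD _ _) _.
  by rewrite -natr1 mulrDl mul1r lerD // normrM normrX nz expr1n mul1r.
have : (q%:R : algC) <= q%:R * (q%:R * `|1 - z|).
  have {1}-> : (q%:R : algC) = `|\sum_(f < q) (1 - z ^+ f)|.
    by rewrite sumrB (sum_unity_root zq z1) subr0 sumr_const card_ord normr_nat.
  apply: le_trans (ler_norm_sum _ _ _) _.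
  have -> : q%:R * (q%:R * `|1 - z|) = \sum_(f < q) (q%:R * `|1 - z|).
    by rewrite sumr_const card_ord mulr_natl.
  apply: ler_sum => f _; apply: le_trans (le1 f) _.
  by rewrite ler_wpM2r // ler_nat ltnW.
by rewrite -{1}[q%:R]mulr1 ler_pM2l // ltr0n.
Qed.

(** Parallelogram law [|1 + z|^2 + |1 - z|^2 = 4], with the lower bound on [|1 - z|]. *)
Lemma norm_half_unity_root (q : nat) (z : algC) : (0 < q)%N -> z ^+ q = 1 -> z != 1 ->
  `|(1 + z) / 2| ^+ 2 <= 1 - (4 * q ^ 2)%:R^-1.
Proof.
move=> q0 zq z1; have nz := norm_unity_root q0 zq.
have zz : z * z^* = 1 by rewrite -normCK nz expr1n.
have q0' : 0 < q%:R :> algC by rewrite ltr0n.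
have -> : `|(1 + z) / 2| ^+ 2 = 1 - `|1 - z| ^+ 2 / 4.
  rewrite !normCK rmorphM rmorphD rmorphB rmorph1 fmorphV rmorph_nat.
  have -> : (1 + z) / 2 * ((1 + z^*) / 2) =
            1 - (1 - z) * (1 - z^*) / 4 + (z * z^* - 1) / 2 by field.
  by rewrite zz subrr mul0r addr0.
rewrite lerD2l lerN2 natrM invfM mulrC ler_wpM2r ?invr_ge0 //.
rewrite -div1r ler_pdivrMr ?natrX ?exprn_gt0 // -exprMn mulrC.
by rewrite exprn_ege1 // norm_sub_unity_root.
Qed.

(** * Parity characters, Parseval and decay of correlations *)

Lemma flipK (n : nat) (i : 'I_n) : involutive (fun x : cube n => flip x i).
Proof. by move=> x; apply/ffunP => j; rewrite !ffunE; case: eqP => // _; rewrite negbK. Qed.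

Definition chi (n m : nat) (g : 'I_m -> cube n -> bool) (T : {set 'I_m}) (x : cube n)
  : algC := \prod_(j in T) (-1) ^+ (g j x).

Definition agree (n m : nat) (g : 'I_m -> cube n -> bool) (D : {set 'I_m})
  (x x' : cube n) : bool := [forall j in D, g j x == g j x'].

Lemma sum_chi (n m : nat) (g : 'I_m -> cube n -> bool) (D : {set 'I_m}) (x x' : cube n) :
  \sum_(T : {set 'I_m} | T \subset D) chi g T x * chi g T x' =
  (agree g D x x')%:R * 2 ^+ #|D|.
Proof.
pose a j : algC := (-1) ^+ (g j x) * (-1) ^+ (g j x').
have aE j : 1 + a j = (g j x == g j x')%:R * 2.
  by rewrite /a; case: (g j x); case: (g j x'); rewrite /= ?expr1 ?expr0 ?mulrNN ?mulr1 ?mul1r ?subrr ?mul0r.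
(* The 0 outside [D] kills every [T] not contained in [D] when the product is expanded. *)
have -> : \sum_(T : {set 'I_m} | T \subset D) chi g T x * chi g T x' =
          \prod_j ((if j \in D then a j else 0) + 1).
  rewrite bigA_distr big_mkcond /=; apply: eq_bigr => T _.
  case: ifPn => [TD|].
    rewrite /chi -big_split /= big_mkcond /=; apply: eq_bigr => j _.
    by case: ifP => // /(subsetP TD) ->.
  case/subsetPn => j jT jD.
  by rewrite (bigD1 j) //= jT (negPf jD) mul0r.
rewrite (bigID (mem D)) /= [X in _ * X]big1 ?mulr1; last first.
  by move=> j /negPf ->; rewrite add0r.
under eq_bigr => j jD do rewrite jD addrC aE.
rewrite big_split /= prodr_const; congr (_ * _).
rewrite /agree; case: forall_inP => [h|h].
  by rewrite big1 // => j jD; rewrite h.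
have /existsP [j /andP[jD jn]] : [exists j, (j \in D) && (g j x != g j x')].
  apply/existsPn => hn; apply: h => j jD.
  by have := hn j; rewrite jD negbK.
by rewrite (bigD1 j) //= (negPf jn) mul0r.
Qed.

Definition psi (n m : nat) (g : 'I_m -> cube n -> bool) (A : {set 'I_n}) (z : algC)
  (T : {set 'I_m}) : algC := \sum_(x : cube n) z ^+ weight_on A x * chi g T x.

Lemma chi_conj n m (g : 'I_m -> cube n -> bool) T x : (chi g T x)^* = chi g T x.
Proof.
rewrite /chi rmorph_prod; apply: eq_bigr => j _.
by rewrite rmorphXn rmorphN1.
Qed.

Lemma norm_chi n m (g : 'I_m -> cube n -> bool) T x : `|chi g T x| = 1.
Proof.
rewrite /chi normr_prod big1 // => j _.
by rewrite normrX normrN1 expr1n.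
Qed.

(** Parseval: after expanding the square, orthogonality of the characters leaves the pairs that
    agree on [D]. *)
Lemma sum_norm_psi (n m : nat) (g : 'I_m -> cube n -> bool) (A : {set 'I_n})
    (z : algC) (D : {set 'I_m}) :
  \sum_(T : {set 'I_m} | T \subset D) `|psi g A z T| ^+ 2 =
  2 ^+ #|D| * \sum_x \sum_(x' | agree g D x x') z ^+ weight_on A x * (z^*) ^+ weight_on A x'.
Proof.
transitivity (\sum_x \sum_x' z ^+ weight_on A x * z^* ^+ weight_on A x' *
   \sum_(T : {set 'I_m} | T \subset D) chi g T x * chi g T x').
  under eq_bigr => T _.
    rewrite normCK /psi rmorph_sum big_distrl /=.
    under eq_bigr => x _ do rewrite big_distrr /=.
    over.
  rewrite exchange_big /=; apply: eq_bigr => x _.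
  rewrite exchange_big /=; apply: eq_bigr => x' _.
  rewrite big_distrr /=; apply: eq_bigr => T _.
  by rewrite rmorphM /= rmorphXn /= chi_conj mulrACA.
rewrite big_distrr /=; apply: eq_bigr => x _.
rewrite big_distrr [RHS]big_mkcond /=; apply: eq_bigr => x' _.
by rewrite sum_chi; case: (agree _ _ _ _); rewrite ?mul0r ?mulr0 // mul1r mulrC.
Qed.

(** Pairing [x] with [flip x i] averages the factor over the two values of the bit. *)
Lemma sum_flip_half (n : nat) (i : 'I_n) (z : algC) (H : cube n -> algC) :
  (forall x, H (flip x i) = H x) ->
  \sum_(x : cube n) z ^+ (x i) * H x = (1 + z) / 2 * \sum_x H x.
Proof.
move=> Hi.
have E : \sum_(x : cube n) z ^+ (x i) * H x = \sum_(x : cube n) z ^+ (~~ x i) * H x.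
  rewrite (reindex_inj (can_inj (@flipK n i))) /=; apply: eq_bigr => x _.
  by rewrite Hi ffunE eqxx.
have : (\sum_(x : cube n) z ^+ (x i) * H x) *+ 2 = (1 + z) * \sum_x H x.
  rewrite mulr2n {2}E -big_split big_distrr /=; apply: eq_bigr => x _.
  by rewrite -mulrDl; case: (x i); rewrite /= ?expr1 ?expr0 // addrC.
move=> h; rewrite mulrAC -h -mulr_natr mulfK ?pnatr_eq0 //.
Qed.

(** Each variable of [U] is invisible to [chi g T], so its factor [(1 + z) / 2] splits off; what
    remains is bounded trivially. *)
Lemma norm_psi_le (n m : nat) (g : 'I_m -> cube n -> bool) (A U : {set 'I_n})
    (z : algC) (T : {set 'I_m}) :
  `|z| = 1 -> U \subset A ->
  (forall i, i \in U -> forall j, j \in T -> forall x, g j (flip x i) = g j x) ->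
  `|psi g A z T| <= 2 ^+ n * `|(1 + z) / 2| ^+ #|U|.
Proof.
move=> nz; move: {2}#|U| (erefl #|U|) => u; elim: u U A => [|u IHu] U A cU UA hU.
  rewrite cU expr0 mulr1; apply: le_trans (ler_norm_sum _ _ _) _.
  under eq_bigr => x _ do rewrite normrM norm_chi normrX nz expr1n mulr1.
  by rewrite sumr_const card_ffun card_bool card_ord natrX.
have [i iU] : exists i, i \in U by apply/set0Pn; rewrite -card_gt0 cU.
have iA := subsetP UA i iU.
have -> : psi g A z T = (1 + z) / 2 * psi g (A :\ i) z T.
  rewrite /psi -(@sum_flip_half _ i); last first.
    move=> x; congr (z ^+ _ * _).
      apply: eq_bigr => l; rewrite !inE => /andP[/negPf li _].
      by rewrite ffunE li.
    by apply: eq_bigr => j jT; rewrite hU.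
  by apply: eq_bigr => x _; rewrite mulrA -exprD /weight_on (big_setD1 i).
rewrite normrM cU exprS mulrCA ler_wpM2l //.
have cU' : #|U :\ i| = u by move: cU; rewrite (cardsD1 i) iU => -[].
rewrite -cU'; apply: IHu; rewrite ?cU' ?setSD //.
by move=> l; rewrite !inE => /andP[_ lU]; exact: hU.
Qed.

Lemma bernoulli_ge (x : algC) (a : nat) : 0 <= x -> 1 + a%:R * x <= (1 + x) ^+ a.
Proof.
move=> x0; elim: a => [|a IHa]; first by rewrite mul0r addr0 expr0.
rewrite exprS; apply: le_trans (ler_wpM2l _ IHa); last by rewrite addr_ge0.
have -> : (1 + x) * (1 + a%:R * x) = 1 + a.+1%:R * x + a%:R * x * x.
  by rewrite -natr1; ring.
by rewrite lerDl !mulr_ge0.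
Qed.

(** Since [(1 - 1/a)^a * (1 + 1/a)^a <= 1] and [(1 + 1/a)^a >= 2] by Bernoulli. *)
Lemma expr_sub_inv_le (a s : nat) : (0 < a)%N ->
  (1 - a%:R^-1 : algC) ^+ (a * s) <= 2^-1 ^+ s.
Proof.
move=> a0; rewrite exprM.
have a0' : 0 < a%:R :> algC by rewrite ltr0n.
have ge0 : 0 <= 1 - a%:R^-1 :> algC.
  by rewrite subr_ge0 invf_le1 // ler1n.
suff h : (1 - a%:R^-1 : algC) ^+ a <= 2^-1 by rewrite lerXn2r // nnegrE ?exprn_ge0 ?invr_ge0.
rewrite -[2^-1]mul1r ler_pdivlMr //.
have le2 : 2 <= (1 + a%:R^-1 : algC) ^+ a.
  apply: le_trans (bernoulli_ge _ _); last by rewrite invr_ge0.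
  by rewrite mulfV ?gt_eqF.
apply: le_trans (ler_wpM2l (exprn_ge0 _ ge0) le2) _.
rewrite -exprMn -subr_sqr expr1n exprn_ile1 //.
  by rewrite subr_ge0 exprn_ile1 // ?invr_ge0 // invf_le1 // ler1n.
by rewrite lerBlDr lerDl exprn_ge0 // invr_ge0.
Qed.

(** A geometric sum of a root of unity, equal to [q] or 0. Pairs that disagree under [g] can thus be
    dropped from a lower bound. *)
Lemma sum_unity_pair_ge0 (q a b : nat) (w : algC) : (0 < q)%N -> w ^+ q = 1 ->
  0 <= \sum_(f < q) (w ^+ f) ^+ a * ((w ^+ f)^*) ^+ b.
Proof.
move=> q0 wq; pose y := w ^+ a * w^* ^+ b.
have -> : \sum_(f < q) (w ^+ f) ^+ a * ((w ^+ f)^*) ^+ b = \sum_(f < q) y ^+ f.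
  apply: eq_bigr => f _.
  by rewrite rmorphXn /= /y exprMn -!exprM ![(_ * f)%N]mulnC.
have [->|y1] := eqVneq y 1.
  by rewrite sumr_ge0 // => f _; rewrite expr1n.
rewrite sum_unity_root // /y exprMn -!exprM ![(_ * q)%N]mulnC !exprM.
by rewrite -rmorphXn wq rmorph1 !expr1n mulr1.
Qed.

Lemma unity_conj_expr (z : algC) (a : nat) : `|z| = 1 -> z ^+ a * z^* ^+ a = 1.
Proof. by move=> nz; rewrite -exprMn -normCK nz !expr1n. Qed.

Lemma card_lt_of_weight_determined (n m d : nat) (g : 'I_m -> cube n -> bool)
    (A : {set 'I_n}) (Nb : 'I_n -> {set 'I_m}) :
  (forall i, i \in A -> (#|Nb i| <= d)%N) ->
  (forall i, i \in A -> forall j, j \notin Nb i -> forall x, g j (flip x i) = g j x) ->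
  (forall x x', (forall j, g j x = g j x') -> weight_on A x = weight_on A x') ->
  (#|A| < 8 * (2 ^ d.+1) ^ 3 * (m + d + 3))%N.
Proof.
move=> degA indA detA; rewrite ltnNge; apply/negP => bigA.
(* [q] makes [q * 2^-d = 2]; [s] makes [q * 2^m * 2^-s = 1/4]; [u0] unread variables damp [|psi|^2]
   by [2^-s], and [q * u0] is at most half of [#|A|]. *)
set q := (2 ^ d.+1)%N in bigA; pose s := (m + d + 3)%N; pose u0 := (4 * q ^ 2 * s)%N.
have q0 : (0 < q)%N by rewrite expn_gt0.
have q1 : (1 < q)%N by rewrite -[1%N](expn0 2) ltn_exp2l.
have four : 4 ^+ n = (2 ^+ n) ^+ 2 :> algC by rewrite exprAC -(natrX _ 2 2).
have [w wP] := C_prim_root_exists q0.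
have wq : w ^+ q = 1 by exact: prim_expr_order.
have wfq (f : nat) : (w ^+ f) ^+ q = 1 by rewrite exprAC wq expr1n.
have nwf (f : nat) : `|w ^+ f| = 1 by exact: norm_unity_root q0 (wfq f).
pose P (f : nat) T := `|psi g A (w ^+ f) T| ^+ 2.
have P0 f T : 0 <= P f T by rewrite exprn_ge0.
pose E : algC := \sum_x \sum_(x' | agree g setT x x') 1.
pose Z : algC := 2 ^+ m * E.
have sumP f : \sum_T P f T = Z.
  rewrite (eq_bigl (fun T : {set 'I_m} => T \subset setT)); last by move=> T; rewrite subsetT.
  rewrite sum_norm_psi cardsT card_ord; congr (_ * _).
  apply: eq_bigr => x _; apply: eq_bigr => x' /forall_inP h.
  rewrite (@detA x x') ?unity_conj_expr // => j.
  by apply/eqP/h; rewrite inE.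
(* The single term [f = 0], [T = set0] already contributes [4 ^+ n]. *)
have Zge : 4 ^+ n <= Z.
  rewrite -(sumP 0%N) (bigD1 set0) //= ler_wpDr ?sumr_ge0 //.
  rewrite /P /psi /chi.
  under eq_bigr => x _ do rewrite big_set0 expr0 expr1n mulr1.
  rewrite sumr_const card_ffun card_bool card_ord natrX normrX normr_nat.
  by rewrite four.
have Zgt0 : 0 < Z by apply: lt_le_trans Zge; rewrite exprn_gt0.
pose D i := ~: Nb i.
have key i : i \in A ->
  Z <= \sum_(f < q | f != 0%N :> nat) \sum_(T : {set 'I_m} | T \subset D i) P f T.
  move=> iA.
  (* Each pair agreeing under all of [g] contributes [q], every other pair at least 0, and [D i] has
     at least [m - d] elements. *)
  have tot : 2 * Z <= \sum_(f < q) \sum_(T : {set 'I_m} | T \subset D i) P f T.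
    have -> : \sum_(f < q) \sum_(T : {set 'I_m} | T \subset D i) P f T =
      2 ^+ #|D i| * \sum_x \sum_(x' | agree g (D i) x x')
        \sum_(f < q) (w ^+ f) ^+ weight_on A x * ((w ^+ f)^*) ^+ weight_on A x'.
      under eq_bigr => f _ do rewrite sum_norm_psi.
      rewrite -big_distrr exchange_big /=; congr (_ * _); apply: eq_bigr => x _.
      by rewrite exchange_big.
    apply: (@le_trans _ _ (2 ^+ #|D i| * \sum_x \sum_(x' | agree g setT x x') q%:R)).
      have -> : \sum_x \sum_(x' | agree g setT x x') q%:R = q%:R * E :> algC.
        rewrite /E big_distrr; apply: eq_bigr => x _ /=.
        by rewrite big_distrr /=; apply: eq_bigr => x' _; rewrite mulr1.
      rewrite /Z !mulrA ler_wpM2r //.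
        by rewrite sumr_ge0 // => x _; rewrite sumr_ge0.
      rewrite natrX -exprD -exprS ler_eXn2l ?ltr1n //.
      by have := cardsC (Nb i); have := degA i iA; rewrite card_ord /D; lia.
    rewrite ler_wpM2l ?exprn_ge0 //; apply: ler_sum => x _.
    rewrite big_mkcond [X in _ <= X]big_mkcond /=; apply: ler_sum => x' _.
    case: ifP => [/forall_inP h|_].
      have -> : agree g (D i) x x' by apply/forall_inP => j _; rewrite h ?inE.
      rewrite (@detA x x'); last by move=> j; apply/eqP/h; rewrite inE.
      under eq_bigr => f _ do rewrite unity_conj_expr //.
      by rewrite sumr_const card_ord.
    by case: ifP => // _; exact: sum_unity_pair_ge0.
  have {tot} : 2 * Z <= Z + \sum_(f < q | f != 0%N :> nat) \sum_(T : {set 'I_m} | T \subset D i) P f T.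
    apply: le_trans tot _; rewrite (bigD1 (Ordinal q0)) //= lerD2r.
    by rewrite -(sumP 0%N) big_mkcond; apply: ler_sum => T _; case: ifP.
  by rewrite mulr_natl mulr2n lerD2l.
pose U (T : {set 'I_m}) := [set i in A | T \subset D i].
have sumU : #|A|%:R * Z <= \sum_(f < q | f != 0%N :> nat) \sum_T #|U T|%:R * P f T.
  rewrite mulr_natl -sumr_const; apply: le_trans (ler_sum _ key) _.
  rewrite exchange_big /=; apply: ler_sum => f _.
  rewrite (exchange_big_dep predT) //=; apply: ler_sum => T _.
  rewrite le_eqVlt; apply/orP; left; apply/eqP.
  by rewrite mulr_natl -sumr_const; apply: eq_bigl => i; rewrite inE.
have ge0 : 0 <= #|A|%:R * 4 ^+ n * 2^-1 ^+ s :> algC.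
  by rewrite !mulr_ge0 ?exprn_ge0 ?invr_ge0.
(* Either [T] leaves at most [u0] variables of [A] unread, or [P f T] is at most [4^n * 2^-s]. *)
have bnd (f : 'I_q) T : f != 0%N :> nat ->
  #|U T|%:R * P f T <= u0%:R * P f T + #|A|%:R * 4 ^+ n * 2^-1 ^+ s.
  move=> f0; have [le|lt] := leqP #|U T| u0.
    by rewrite ler_wpDr // ler_wpM2r // ler_nat.
  rewrite ler_wpDl ?mulr_ge0 // -mulrA ler_pM //.
    by rewrite ler_nat subset_leq_card //; apply/subsetP => i; rewrite inE => /andP[].
  have w1 : w ^+ f != 1.
    by rewrite -(prim_order_dvd wP); apply/negP => /dvdn_leq; rewrite lt0n f0 leqNgt ltn_ord => /(_ isT).
  have psile : `|psi g A (w ^+ f) T| <= 2 ^+ n * `|(1 + w ^+ f) / 2| ^+ #|U T|.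
    apply: norm_psi_le => //.
      by apply/subsetP => i; rewrite inE => /andP[].
    move=> i; rewrite inE => /andP[iA /subsetP TD] j /TD; rewrite inE => jN x.
    exact: indA.
  rewrite /P; apply: le_trans (_ : (2 ^+ n * `|(1 + w ^+ f) / 2| ^+ #|U T|) ^+ 2 <= _).
    by rewrite lerXn2r // nnegrE mulr_ge0 ?exprn_ge0.
  rewrite four exprMn ler_wpM2l ?exprn_ge0 // exprAC.
  have rho := norm_half_unity_root q0 (wfq f) w1.
  have q4 : (0 < 4 * q ^ 2)%N by rewrite muln_gt0 expn_gt0 q0.
  apply: le_trans (expr_sub_inv_le s q4).
  apply: le_trans (_ : (`|(1 + w ^+ f) / 2| ^+ 2) ^+ u0 <= _).
    apply: ler_wiXn2l (ltnW lt) => //.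
      by rewrite exprn_ge0.
    by apply: le_trans rho _; rewrite lerBlDr lerDl invr_ge0.
  by rewrite lerXn2r // nnegrE ?exprn_ge0 //; apply: le_trans rho; rewrite exprn_ge0.
have cS : #|{set 'I_m}| = (2 ^ m)%N.
  by rewrite -cardsT -powersetT card_powerset cardsT card_ord.
have : #|A|%:R * Z <= q%:R * (u0%:R * Z + 2 ^+ m * (#|A|%:R * 4 ^+ n * 2^-1 ^+ s)).
  apply: le_trans sumU _.
  apply: (@le_trans _ _ (\sum_(f < q) (u0%:R * Z + 2 ^+ m * (#|A|%:R * 4 ^+ n * 2^-1 ^+ s)))).
    rewrite big_mkcond; apply: ler_sum => f _; case: ifP => [f0|_]; last first.
      by rewrite addr_ge0 // mulr_ge0 ?exprn_ge0 // ltW.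
    apply: le_trans (ler_sum _ (fun T _ => bnd f T f0)) _.
    rewrite big_split /= -big_distrr /= sumP sumr_const cS lerD2l.
    by rewrite -[X in X <= _]mulr_natl natrX.
  by rewrite sumr_const card_ord -[X in X <= _]mulr_natl.
have A0 : 0 < #|A|%:R :> algC.
  rewrite ltr0n; apply: leq_trans bigA.
  by rewrite muln_gt0 addn3 andbT muln_gt0 expn_gt0 q0.
have qu : q%:R * u0%:R <= #|A|%:R / 2 :> algC.
  rewrite ler_pdivlMr // -!natrM ler_nat; apply: leq_trans bigA.
  by rewrite /u0 -/s; lia.
have qs : q%:R * (2 ^+ m * 2^-1 ^+ s) = 4^-1 :> algC.
  rewrite natrX mulrA -exprD exprVn /s.
  have -> : (m + d + 3 = (d.+1 + m) + 2)%N by lia.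
  set a := (d.+1 + m)%N.
  by rewrite exprD invfM mulrA mulfV ?expf_neq0 ?pnatr_eq0 // mul1r -natrX.
have -> : q%:R * (u0%:R * Z + 2 ^+ m * (#|A|%:R * 4 ^+ n * 2^-1 ^+ s)) =
          q%:R * u0%:R * Z + #|A|%:R * 4 ^+ n * (q%:R * (2 ^+ m * 2^-1 ^+ s)) by ring.
rewrite qs => h.
(* The right side is only three quarters of the left, a contradiction. *)
have {h} : #|A|%:R * Z <= #|A|%:R / 2 * Z + #|A|%:R * Z / 4.
  apply: le_trans h _; apply: lerD; first by rewrite ler_wpM2r // ltW.
  by rewrite ler_wpM2r ?invr_ge0 // ler_wpM2l // ltW.
rewrite -subr_ge0.
have -> : #|A|%:R / 2 * Z + #|A|%:R * Z / 4 - #|A|%:R * Z = - (#|A|%:R * Z / 4) by field.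
have Z4 : 0 < #|A|%:R * Z / 4 by exact: divr_gt0 (mulr_gt0 A0 Zgt0) (ltr0Sn _ 3).
by rewrite oppr_ge0 lt_geF.
Qed.

Local Close Scope ring_scope.

(** * Majority *)

(** The first alternative is the case where neighbourhoods are too large to split. In the second,
    [256 * 32 ^ d] is the splitting loss [4 * 4 ^ d] times [8 * (2 ^ d.+1) ^ 3] from the weight
    bound. *)
Lemma Maj_composable_bound (n k m : nat) : 0 < n -> 0 < k -> composable k (@Maj n) m ->
  exists d, [/\ d * n <= 2 * m * k, n <= m * k &
    n < 4 * d * k \/ n < 256 * 32 ^ d * (m + d + 3)].
Proof.
move=> n0 k0 [g [h [locg gh]]].
have [S SP] := fin_all_exists locg.
have cS j : #|S j| = k by case: (SP j).
have gS j x i : i \notin S j -> g j x = g j (flip x i) by case: (SP j) => _; apply.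
have rd := Maj_all_read gS gh.
pose Nb i := [set j in setT | i \in S j]; pose d := 2 * m * k %/ n.
exists d; split; first exact: leq_divM.
  have := sum_degree setT cS; rewrite cardsT card_ord => <-.
  rewrite -[X in X <= _]card_ord -sum1_card; apply: leq_sum => i _.
  by rewrite card_gt0; apply/set0Pn; have [j ij] := rd i; exists j; rewrite !inE.
have [lt|le] := ltnP n (4 * d * k); first by left.
right; pose L := [set i | #|Nb i| <= d].
have cL : n <= 2 * #|L| by exact: card_low_degree n0 cS.
have degL i : i \in L -> #|Nb i| <= d by rewrite inE.
have [||G] := @exists_splitting n m d (d * k) L Nb degL; last 1 first.
- set U := [set i in L | _]; set V := [set i in L | _] => UV.
  have UL : #|U| <= #|L| by apply: subset_leq_card; apply/subsetP => i; rewrite inE => /andP[].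
  have VL : #|V| <= #|L| by apply: subset_leq_card; apply/subsetP => i; rewrite inE => /andP[].
  have L0 : 0 < #|L| by lia.
  have bU : #|L| <= 2 * 4 ^ d * #|U|.
    rewrite -(leq_pmul2r L0) mulnn; apply: leq_trans UV _.
    by rewrite mulnA leq_mul2l VL orbT.
  have bV : #|L| <= 2 * 4 ^ d * #|V|.
    rewrite -(leq_pmul2r L0) mulnn; apply: leq_trans UV _.
    by rewrite [#|U| * _]mulnC mulnA leq_mul2l UL orbT.
  (* [A] and [B] must have equal size. Each of [U] and [V] is large because the other has at most
     [#|L|] elements. *)
  pose N := minn #|U| #|V|.
  have [|A AU cA] := @exists_subset_card _ U N; first exact: geq_minl.
  have [|B BV cB] := @exists_subset_card _ V N; first exact: geq_minr.
  have bN : n <= 4 * 4 ^ d * N.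
    by rewrite /N; case: (leqP #|U| #|V|) => _; lia.
  have AG i j : i \in A -> i \in S j -> j \in G.
    move=> /(subsetP AU); rewrite inE => /andP[_ /subsetP NG] iS.
    by apply: NG; rewrite !inE.
  have BG i j : i \in B -> i \in S j -> j \notin G.
    move=> /(subsetP BV); rewrite inE => /andP[_ dNG] iS.
    by rewrite (disjointFr dNG) // !inE.
  (* A common variable would be read by some function, which would lie both in [G] and outside
     it. *)
  have dAB : [disjoint A & B].
    rewrite disjoints_subset; apply/subsetP => i iA; rewrite inE; apply/negP => iB.
    by have [j ij] := rd i; have := BG i j iB ij; rewrite (AG i j iA ij).
  have [|z zP] := Maj_weight_determined gS gh dAB _ AG BG; first by rewrite cA cB.
  have := @card_lt_of_weight_determined n m d (fun j x => g j (patch A z x)) A Nb.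
  rewrite cA => /(_ _ _ zP) ltN.
  have {ltN} : N < 8 * (2 ^ d.+1) ^ 3 * (m + d + 3).
    apply: ltN => [i /(subsetP AU)|i iA j].
      by rewrite inE => /andP[/degL].
    rewrite !inE => ij x; rewrite (gS j _ i ij); congr (g j _).
    by apply/ffunP => l; rewrite !ffunE; have [->|] := eqVneq l i; rewrite ?iA ?negbK.
  have -> : (2 ^ d.+1) ^ 3 = 8 * 8 ^ d.
    by rewrite expnAC -[2 ^ 3]/8 expnS.
  have -> : 32 ^ d = 4 ^ d * 8 ^ d by rewrite -expnMn.
  move=> ltN; apply: leq_ltn_trans bN _.
  have : 4 * 4 ^ d * N < 4 * 4 ^ d * (8 * (8 * 8 ^ d) * (m + d + 3)).
    by rewrite ltn_pmul2l // muln_gt0 expn_gt0.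
  by congr (_ < _); ring.
(* At most [d] functions read [i], and each reads [k] variables. *)
- move=> i iL; apply: leq_trans (_ : #|Nb i| * k <= _); last by rewrite leq_mul2r degL ?orbT.
  rewrite -(sum_degree (Nb i) cS) -sum1_card big_mkcond; apply: leq_sum => i' _.
  case: ifP => //; rewrite inE => /andP[_]; rewrite -setI_eq0 => /set0Pn[j].
  rewrite !inE /= => /andP[ij i'j]; rewrite card_gt0; apply/set0Pn; exists j.
  by rewrite !inE /= ij.
- by lia.
Qed.

Local Open Scope ring_scope.

(** * From the counting bound to logarithms *)

Lemma ln2_ge_half (R : realType) : 2^-1 <= ln 2 :> R.
Proof.
have h : ln (1 + - 2^-1) <= - 2^-1 :> R by apply: le_ln1Dx; lra.
have E : 1 + - 2^-1 = 2^-1 :> R by lra.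
by move: h; rewrite E lnV ?posrE // lerN2.
Qed.

(** Write [k = r * (n / m)] with [r = m * k / n >= 1]. Then [ln r <= r <= 2 * r * ln 2], and
    [n / m <= 2^11 * 32^d] with [d <= 2 * r] adds [(11 + 10) * r * ln 2], whence 23. *)
Lemma ln_le_ratio (R : realType) (n k m d : nat) : (0 < n)%N -> (0 < k)%N -> (k <= n)%N ->
  (d * n <= 2 * m * k)%N -> (n <= m * k)%N -> (n < 256 * 32 ^ d * (m + d + 3))%N ->
  ln k%:R <= 23 * (m%:R * k%:R / n%:R) * ln 2 :> R.
Proof.
move=> n0 k0 kn dn nm bnd.
have m0 : (0 < m)%N by lia.
have d2 : (d <= 2 * m)%N.
  have : (d * n <= 2 * m * n)%N by apply: leq_trans dn _; rewrite leq_mul2l kn orbT.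
  by rewrite leq_pmul2r.
have {}bnd : (n <= 2 ^ 11 * 32 ^ d * m)%N.
  apply: (leq_trans (ltnW bnd)).
  have -> : (2 ^ 11 * 32 ^ d * m = 256 * 32 ^ d * (8 * m))%N by rewrite -[(2 ^ 11)%N]/(256 * 8)%N; ring.
  by rewrite leq_mul2l; apply/orP; right; lia.
have n0' : 0 < n%:R :> R by rewrite ltr0n.
have k0' : 0 < k%:R :> R by rewrite ltr0n.
have m0' : 0 < m%:R :> R by rewrite ltr0n.
set r := m%:R * k%:R / n%:R.
have r1 : 1 <= r by rewrite ler_pdivlMr // mul1r -natrM ler_nat.
have dr : d%:R <= 2 * r.
  by rewrite /r mulrA ler_pdivlMr // mulrA -!natrM ler_nat.
have kE : k%:R = r * (n%:R / m%:R) by rewrite /r; field; rewrite !gt_eqF.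
have nmle : n%:R / m%:R <= 2 ^+ 11 * 32 ^+ d :> R.
  by rewrite ler_pdivrMr // -!natrX -!natrM ler_nat.
have lnX (x : R) (a : nat) : 0 < x -> ln (x ^+ a) = a%:R * ln x.
  by move=> x0; rewrite lnXn // mulr_natl.
have p2 (a : nat) : 0 < 2 ^+ a :> R by rewrite exprn_gt0 // ltr0n.
have p32 (a : nat) : 0 < 32 ^+ a :> R by rewrite exprn_gt0 // ltr0n.
have ln32 : ln 32 = 5 * ln 2 :> R.
  by rewrite -(lnX _ 5%N) ?ltr0n // -natrX.
have lnnm : ln (n%:R / m%:R) <= 11 * ln 2 + d%:R * (5 * ln 2) :> R.
  rewrite -ln32 -(lnX _ 11%N) ?ltr0n // -(lnX _ d) ?ltr0n // -lnM ?posrE //.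
  by rewrite ler_ln ?posrE ?divr_gt0 ?mulr_gt0.
have r0 : 0 < r := lt_le_trans ltr01 r1.
have lnr : ln r <= r by exact: ltW (ln_sublinear r0).
have l2 := ln2_ge_half R.
have t0 : 0 < n%:R / m%:R :> R by rewrite divr_gt0.
rewrite kE lnM ?posrE //.
have : d%:R * (5 * ln 2) <= 2 * r * (5 * ln 2) by apply: ler_wpM2r => //; lra.
nra.
Qed.

Theorem mainTheorem1 (R : realType) (eps : R) (eps_gt0 : 0 < eps) :
  exists2 c : R, 0 < c &
    forall n k : nat, (0 < n)%N -> (0 < k)%N -> k%:R <= n%:R `^ (1 - eps) :> R ->
      c * (n%:R / k%:R) * log2 (k%:R : R) <= (CC k (@Maj n))%:R.
Proof.
have l2 := ln2_ge_half R; have l2gt0 : 0 < ln 2 :> R by lra.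
(* The first value serves the exponential alternative, the second the case [n < 4 * d * k]. *)
exists (Num.min 23^-1 (eps * ln 2 / 8)).
  by rewrite lt_min invr_gt0 ltr0n /= !mulr_gt0 ?invr_gt0.
move=> n k n0 k0 hk; set c := Num.min _ _.
have n0' : 0 < n%:R :> R by rewrite ltr0n.
have k0' : 0 < k%:R :> R by rewrite ltr0n.
have n1 : 1 <= n%:R :> R by rewrite ler1n.
(* This guarantees that a composition exists, so [CC] is not its default value 0. *)
have kn : (k <= n)%N.
  rewrite -(ler_nat R); apply: (le_trans hk).
  rewrite -[leRHS](powRr1 (ltW n0')); apply: ler_powR => //.
  by rewrite gerBl ltW.
have [d [dn nm bnd]] := Maj_composable_bound n0 k0 (CC_composable (@Maj n) k0 kn).
set m := CC k (@Maj n) in dn nm bnd *.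
have lnk : 0 <= ln k%:R :> R by rewrite ln_ge0 // ler1n.
have t0 : 0 < n%:R / k%:R :> R by rewrite divr_gt0.
have [c1 c2] : c <= 23^-1 /\ c <= eps * ln 2 / 8 by rewrite /c !ge_min !lexx orbT.
have lk0 : 0 <= ln k%:R / ln 2 :> R by rewrite divr_ge0 // ltW.
rewrite /log2; case: bnd => [bnd|bnd].
(* Here [m >= (n / k)^2 / 8], so it suffices that one factor [n / k] dominates [eps * ln k]. *)
- have mk : (n * n <= 8 * m * k * k)%N.
    apply: (@leq_trans (4 * d * k * n)); first by rewrite leq_mul2r ltnW ?orbT.
    have -> : (4 * d * k * n = 4 * k * (d * n))%N by ring.
    have -> : (8 * m * k * k = 4 * k * (2 * m * k))%N by ring.
    by rewrite leq_mul2l dn orbT.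
  have tt : (n%:R / k%:R) * (n%:R / k%:R) <= 8 * m%:R :> R.
    by rewrite mulrACA -invfM ler_pdivrMr ?mulr_gt0 // mulrA -!natrM ler_nat.
  (* [eps * ln k <= k^eps <= n^eps], and [n^eps <= n / k] by the hypothesis on [k]. *)
  have tk : eps * ln k%:R <= n%:R / k%:R :> R.
    rewrite ler_pdivlMr //; apply: (@le_trans _ _ (n%:R `^ eps * n%:R `^ (1 - eps))).
      apply: ler_pM => //; first by rewrite mulr_ge0 // ltW.
      apply: (@le_trans _ _ (k%:R `^ eps)).
        rewrite /powR gt_eqF //; apply: le_trans (expR_ge1Dx _); lra.
      by apply: ge0_ler_powR; rewrite ?nnegrE ?ler0n ?ler_nat // ltW.
    rewrite -powRD; last by apply/implyP => _; rewrite gt_eqF.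
    by rewrite [eps + _]addrC subrK powRr1 // ltW.
  apply: (@le_trans _ _ (eps * ln 2 / 8 * (n%:R / k%:R) * (ln k%:R / ln 2))).
    by rewrite ler_wpM2r // ler_pM2r.
  have -> : eps * ln 2 / 8 * (n%:R / k%:R) * (ln k%:R / ln 2) =
            (n%:R / k%:R) * (eps * ln k%:R) / 8 :> R.
    by field; rewrite !gt_eqF.
  rewrite ler_pdivrMr // [leRHS]mulrC; apply: le_trans tt.
  by rewrite ler_pM2l.
- have lk := ln_le_ratio R n0 k0 kn dn nm bnd.
  apply: (@le_trans _ _ (23^-1 * (n%:R / k%:R) * (ln k%:R / ln 2))).
    by rewrite ler_wpM2r // ler_pM2r.
  apply: (@le_trans _ _ (23^-1 * (n%:R / k%:R) * (23 * (m%:R * k%:R / n%:R)))).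
    by rewrite ler_pM2l ?mulr_gt0 ?invr_gt0 // ler_pdivrMr.
  by rewrite le_eqVlt; apply/orP; left; apply/eqP; field; rewrite !gt_eqF.
Qed.
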